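(* Let $H$ be a real Hilbert space and let $\gamma>0$, $L>0$. Let $B:H\to H$ be a single-valued $L$-Lipschitz continuous mapping, and let $A:H\rightrightarrows H$ be a set-valued mapping such that the resolvent $J_{\gamma A}=(Id+\gamma A)^{-1}$ is well-defined and single-valued on $H$ and such that $A+B$ is maximally monotone. Suppose that the solution set $S:=(A+B)^{-1}(0)=\{x\in H: 0\in Ax+Bx\}$ is nonempty and that $\gamma^2L^2\le 1-\varepsilon$ for some $\varepsilon>0$. Then, for every $x_0\in H$, the sequence $(x_k)_{k\ge 0}$ generated by Tseng's algorithm $$ \begin{cases} y_k=J_{\gamma A}(x_k-\gamma Bx_k),\\ x_{k+1}=y_k+\gamma(Bx_k-By_k), \end{cases}\qquad k\ge 0, $$ converges weakly to some $\tilde{x}\in S$, i.e., to a solution of $0\in Ax+Bx$.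
   Context: $H$ is a real Hilbert space with inner product $\langle\cdot,\cdot\rangle$ and norm $\|\cdot\|$. A mapping $B:H\to H$ is $L$-Lipschitz continuous if $\|Bx-By\|\le L\|x-y\|$ for all $x,y\in H$. A set-valued mapping $\mathcal F:H\rightrightarrows H$ is monotone if $\langle x^*-y^*,x-y\rangle\ge 0$ for all $x,y\in H$, $x^*\in\mathcal F(x)$, $y^*\in\mathcal F(y)$; it is maximally monotone if it is monotone and there is no monotone operator whose graph strictly contains the graph of $\mathcal F$, where the graph is $\{(x,y):x\in H,\ y\in\mathcal F(x)\}$. The sum is $(A+B)x=\{a+Bx: a\in Ax\}$. The resolvent is $J_{\gamma A}:=(Id+\gamma A)^{-1}$, where $Id$ is the identity; that it is well-defined and single-valued on $H$ means that for every $u\in H$ there is exactly one $y\in H$ with $u\in y+\gamma Ay$. Neither $A$ nor $B$ is assumed monotone individually. *)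

(* Defs.v *)
From HB Require Import structures.
From mathcomp Require Import all_boot all_order all_algebra.
From mathcomp Require Import boolp classical_sets reals topology normedtype.

Set Implicit Arguments.
Unset Strict Implicit.
Unset Printing Implicit Defensive.

Import Order.TTheory GRing.Theory Num.Theory.
Import numFieldNormedType.Exports.
Local Open Scope classical_set_scope.
Local Open Scope ring_scope.

(* A set-valued mapping F : H => H is a function F : H -> set H, with y in F(x)
   written F x y.  A real Hilbert space is a complete normed module H over a
   realType R together with a positive definite symmetric bilinear form
   dot : {dot H for idfun} that induces the norm of H. *)

Definition hilbert_dot (R : realType) (H : completeNormedModType R)
    (dot : {dot H for idfun}) : Prop :=
  forall x : H, `|x| ^+ 2 = dot x x.

Section SetValued.
Variables (R : realType) (H : completeNormedModType R).
Implicit Types (F A : H -> set H) (B : H -> H) (dot : {dot H for idfun}).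

Definition graph F : set (H * H) := [set p | F p.1 p.2].

Definition op_inv F : H -> set H := fun u => [set y | F y u].

Definition op_add A B : H -> set H := fun x => [set a + B x | a in A x].

Definition id_add_scale (gamma : R) A : H -> set H :=
  fun y => [set y + gamma *: a | a in A y].

Definition monotone dot F : Prop :=
  forall x y x' y' : H, F x x' -> F y y' -> 0 <= dot (x' - y') (x - y).

Definition max_monotone dot F : Prop :=
  monotone dot F /\ ~ exists G, monotone dot G /\ graph F `<` graph G.

Definition resolvent (gamma : R) A : H -> set H :=
  op_inv (id_add_scale gamma A).

Definition resolvent_single_valued (gamma : R) A : Prop :=
  forall u, exists! y, resolvent gamma A u y.

(* The resolvent as a mapping H -> H; [get] returns the element of the set
   when that set is a singleton, and is only meaningful in that case. *)
Definition res_map (gamma : R) A (u : H) : H := get (resolvent gamma A u).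

Definition tseng_y (gamma : R) A B (x : H) : H :=
  res_map gamma A (x - gamma *: B x).

Definition tseng_step (gamma : R) A B (x : H) : H :=
  let y := tseng_y gamma A B x in y + gamma *: (B x - B y).

Definition tseng (gamma : R) A B (x0 : H) (k : nat) : H :=
  iter k (tseng_step gamma A B) x0.

(* By Riesz representation, testing against the functionals <., h> is testing
   against all continuous linear functionals. *)
Definition weak_cvg dot (x : nat -> H) (l : H) : Prop :=
  forall h : H, (fun k => dot (x k) h) @ \oo --> dot l h.

End SetValued.

(* Main.v *)
(* Fejér monotonicity and Opial's argument. With x' the successor of x and y
   the intermediate point, (x - x') / gamma lies in (A + B) y, so monotonicity
   gives |x' - s|^2 <= |x - s|^2 - (1 - gamma^2 L^2) |x - y|^2 for every
   solution s. Hence |x_k - s| converges and x_k - y_k -> 0. Along any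
   ultrafilter finer than \oo the bounded sequence x_k has a weak limit, given
   by Riesz representation of h |-> lim <x_k, h>; it is a solution because the
   graph of a maximally monotone operator is weak-strong closed. Two such limits
   p, q coincide since <x_k, p - q> converges along \oo. *)
Require Import Defs.
From HB Require Import structures.
From mathcomp Require Import all_boot all_order all_algebra.
From mathcomp Require Import boolp classical_sets reals topology normedtype.
From mathcomp Require Import sequences.
From mathcomp Require Import ring lra.

Set Implicit Arguments.
Unset Strict Implicit.
Unset Printing Implicit Defensive.

Import Order.TTheory GRing.Theory Num.Theory.
Import numFieldNormedType.Exports.
Local Open Scope classical_set_scope.
Local Open Scope ring_scope.

(** * Convergence tested on ultrafilters *)

(** Otherwise some neighbourhood [N] of [l] has its preimage outside [F]; then [F] and the
    complement of that preimage lie in a common ultrafilter, along which [f] cannot tend to [l]. *)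
Lemma cvg_ultra_finer (T : Type) (Y : topologicalType) (F : set_system T)
    (FF : ProperFilter F) (f : T -> Y) (l : Y) :
  (forall U : set_system T, UltraFilter U -> F `<=` U -> f @ U --> l) ->
  f @ F --> l.
Proof.
move=> ultra_cvg N Nl; apply: contrapT => nFN.
have within_proper : ProperFilter (within (~` (f @^-1` N)) F).
  split; last exact: within_filter.
  rewrite /within /= => FN; apply: nFN.
  by apply: filterS FN => t /= ntN; apply: contrapT => /ntN.
have [U [Uultra subU]] := ultraFilterLemma within_proper.
have UC : U (~` (f @^-1` N)) by apply: subU; rewrite /within /=; exact: nearW.
have UN : U (f @^-1` N).
  apply: (ultra_cvg U Uultra _ N Nl) => A FA; apply: subU.
  by apply: filterS FA => t At _.
have UP := @ultra_proper _ _ Uultra.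
have [t []] := filter_ex (filterI UN UC).
by [].
Qed.

Lemma ultra_fmap (T Y : Type) (U : set_system T) (f : T -> Y) :
  UltraFilter U -> UltraFilter (f @ U).
Proof.
move=> UU; have UP := @ultra_proper _ _ UU.
split=> [|G GP fUG]; first exact: fmap_proper_filter.
rewrite predeqE => A; split; last exact: fUG.
move=> GA; have [//|UnA] := in_ultra_setVsetC (f @^-1` A) UU.
have GnA : G (~` A) by exact: fUG.
by have [? []] := filter_ex (filterI GA GnA).
Qed.

(** * Inner product algebra, Cauchy-Schwarz and Riesz representation *)

Section InnerProduct.
Variables (R : realType) (H : completeNormedModType R).
Variable dot : {dot H for idfun}.
Implicit Types (u v w p : H) (a : R).

Lemma dotC u v : dot u v = dot v u.
Proof. by rewrite hermC expr0 mul1r. Qed.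

Lemma dotDl u v w : dot (u + v) w = dot u w + dot v w.
Proof. exact: linearDl. Qed.

Lemma dotNl u w : dot (- u) w = - dot u w.
Proof. exact: linearNl. Qed.

Lemma dotZl a u w : dot (a *: u) w = a * dot u w.
Proof. exact: linearZl_LR. Qed.

Lemma dotDr u v w : dot w (u + v) = dot w u + dot w v.
Proof. exact: linearDr. Qed.

Lemma dotNr u w : dot w (- u) = - dot w u.
Proof. exact: linearNr. Qed.

Lemma dotZr a u w : dot w (a *: u) = a * dot w u.
Proof. by rewrite dotC dotZl dotC. Qed.

Definition dotE := (dotDl, dotDr, dotNl, dotNr, dotZl, dotZr).

Hypothesis dotP : hilbert_dot dot.

Lemma dot_ge0 u : 0 <= dot u u.
Proof. by rewrite -dotP sqr_ge0. Qed.

Lemma cauchy_schwarz u v : `|dot u v| <= `|u| * `|v|.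
Proof.
have [->|v0] := eqVneq v 0.
  by rewrite normr0 mulr0 -(scale0r 0) dotZr mul0r normr0.
have vv_gt0 : 0 < dot v v by rewrite -dotP exprn_gt0 // normr_gt0.
rewrite -ler_sqr ?nnegrE ?mulr_ge0 // exprMn real_normK ?num_real // !dotP.
(* This square is [dot v v] times the Cauchy-Schwarz gap [dot u u * dot v v - dot u v ^+ 2]. *)
have := dot_ge0 (dot v v *: u - dot u v *: v).
rewrite !dotE (dotC v u) => ge0.
rewrite -subr_ge0 -(pmulr_rge0 _ vv_gt0).
apply: le_trans ge0 _; rewrite le_eqVlt; apply/orP; left; apply/eqP; ring.
Qed.

(* The representative minimises [phi z = |z|^2 - 2 f z]: by the parallelogram
   identity the near-minimisers of [phi] form a Cauchy filter. *)
Lemma riesz_representation (f : H -> R) (M : R) :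
  scalar f -> (forall h, `|f h| <= M * `|h|) ->
  exists l, forall h, f h = dot l h.
Proof.
move=> flin fM.
have fD u v : f (u + v) = f u + f v by have := flin 1 u v; rewrite scale1r mul1r.
have f0 : f 0 = 0 by have := fD 0 0; rewrite addr0; lra.
have fZ a u : f (a *: u) = a * f u by have := flin a u 0; rewrite !addr0 f0 addr0.
pose phi z := dot z z - 2 * f z.
have phiDZ a u v :
    phi (u + a *: v) = phi u + 2 * a * (dot u v - f v) + a ^+ 2 * dot v v.
  by rewrite /phi fD fZ !dotE (dotC v u); ring.
have phi_lb z : - M ^+ 2 <= phi z.
  rewrite /phi -dotP; have := fM z; have := ler_norm (f z).
  have := sqr_ge0 (`|z| - M); lra.
have inf_phi : has_inf (range phi).
  split; first by exists (phi 0), 0.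
  by exists (- M ^+ 2) => _ [z _ <-].
pose m := inf (range phi).
have m_le z : m <= phi z by apply: ge_inf; [case: inf_phi|exists z].
pose F := filter_from [set e : R | 0 < e] (fun e => [set z | phi z < m + e]).
have FF : ProperFilter F.
  apply: filter_from_proper.
    apply: filter_from_filter; first by exists 1 => /=.
    move=> e e' /= e0 e'0; exists (Num.min e e') => /=; first by rewrite lt_min e0.
    move=> z /= zlt; split; apply: lt_le_trans zlt _; rewrite lerD2l.
      by rewrite ge_min lexx.
    by rewrite ge_min lexx orbT.
  move=> e /= e0.
  have [_ [z _ <-] zlt] := inf_adherent e0 inf_phi.
  by exists z.
have dist_le (a b : H) : dot (a - b) (a - b) <= 2 * (phi a + phi b - 2 * m).
  (* Twice the value of [phi] at the midpoint falls short of [phi a + phi b] by half of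
     [dot (a - b) (a - b)]. *)
  have := m_le (2^-1 *: (a + b)).
  rewrite /phi fZ fD !dotE (dotC b a); lra.
have Fcauchy : cauchy F.
  apply: cauchy_exP => eps eps0.
  (* By [dist_le], two points whose [phi] is within [eps ^+ 2 / 4] of [m] are closer than [eps]. *)
  have e0 : 0 < eps ^+ 2 / 4 by rewrite divr_gt0 // exprn_gt0.
  have [_ [z _ <-] zlt] := inf_adherent e0 inf_phi.
  exists z; exists (eps ^+ 2 / 4) => // w /= wlt; rewrite -ball_normE /=.
  rewrite -ltr_sqr ?nnegrE ?(ltW eps0) // dotP.
  apply: le_lt_trans (dist_le z w) _.
  rewrite -/m in zlt; lra.
pose l := lim F.
have Fl : F --> l by exact: cauchy_cvg.
have phil : phi l <= m.
  (* [2 * (|l| + M)] bounds the slope of the linear part of [phi] around [l]; adding 1 makes [C] a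
     positive divisor. *)
  pose C := `|2 * (`|l| + M)| + 1.
  have C0 : 0 < C by rewrite ltr_wpDl.
  apply/ler_addgt0Pr => e e0.
  have e2 : 0 < e / 2 by rewrite divr_gt0.
  have near_l : F [set z | `|l - z| < e / 2 / C].
    by move/fcvgrPdist_lt: Fl; apply; rewrite divr_gt0.
  have near_m : F [set z | phi z < m + e / 2] by exists (e / 2).
  have [z [zl zm]] := filter_ex (filterI near_l near_m).
  rewrite /= ltr_pdivlMr // distrC in zl; rewrite /= in zm.
  have := phiDZ 1 l (z - l); rewrite scale1r subrKC.
  have := dot_ge0 (z - l).
  have := cauchy_schwarz l (z - l); have := ler_norm (- dot l (z - l)).
  rewrite normrN; have := fM (z - l); have := ler_norm (f (z - l)).
  have : 2 * (`|l| + M) * `|z - l| <= `|z - l| * C.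
    rewrite mulrC ler_wpM2l // /C.
    by have := ler_norm (2 * (`|l| + M)); lra.
  lra.
exists l => h; apply/eqP; rewrite eq_sym -subr_eq0; apply/eqP.
(* [D] is half the derivative of [phi] at [l] along [h]. The step [- D / K] changes [phi] by
   [- D ^+ 2 * (K + 1) / K ^+ 2], and [K] is positive even for [h = 0]. *)
set D := dot l h - f h; pose K := dot h h + 1.
have K0 : 0 < K by rewrite ltr_wpDl // dot_ge0.
have := m_le (l + (- D / K) *: h).
rewrite phiDZ -/D => mle.
have : 0 <= - D ^+ 2 * (K + 1) / K ^+ 2.
  apply: le_trans (_ : 0 <= 2 * (- D / K) * D + (- D / K) ^+ 2 * dot h h) _.
    lra.
  rewrite le_eqVlt; apply/orP; left; apply/eqP.
  have -> : dot h h = K - 1 by rewrite /K addrK.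
  by field; rewrite gt_eqF.
have KK : 0 < (K + 1) / K ^+ 2.
  by apply: divr_gt0; [exact: addr_gt0|exact: exprn_gt0].
rewrite -mulrA (pmulr_lge0 _ KK) oppr_ge0.
move=> D2; apply/eqP; rewrite -sqrf_eq0; apply/eqP/le_anti.
by rewrite D2 sqr_ge0.
Qed.

(** * Weak limits along ultrafilters *)

(** The values lie in the compact segment from [- C] to [C], where every ultrafilter converges. *)
Lemma ultra_bounded_cvg (T : Type) (U : set_system T) (g : T -> R) (C : R) :
  UltraFilter U -> (forall t, `|g t| <= C) -> cvg (g @ U).
Proof.
move=> UU gC; have UP := @ultra_proper _ _ UU.
have := @segment_compact _ (- C) C; rewrite compact_ultra.
move=> /(_ (g @ U) (ultra_fmap g UU)) [].
  by apply: nearW => t /=; rewrite in_itv /= -ler_norml.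
by move=> p [_ /cvgP].
Qed.

Lemma ultra_bounded_weak_cvg (T : Type) (U : set_system T) (x : T -> H)
    (M : R) :
  UltraFilter U -> (forall t, `|x t| <= M) ->
  exists l, forall h, dot (x t) h @[t --> U] --> dot l h.
Proof.
move=> UU xM; have UP := @ultra_proper _ _ UU.
have dot_le h t : `|dot (x t) h| <= M * `|h|.
  by apply: le_trans (cauchy_schwarz _ _) _; rewrite ler_wpM2r.
have cvg_dot h : cvg (dot (x t) h @[t --> U]).
  by apply: ultra_bounded_cvg UU (dot_le h).
pose f h := lim (dot (x t) h @[t --> U]).
have [a u v|h|l fl] := riesz_representation (f := f) (M := M).
- apply/cvg_lim => //.
  have -> : (fun t => dot (x t) (a *: u + v)) =
            (fun t => a * dot (x t) u + dot (x t) v).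
    by apply/funext => t; rewrite dotDr dotZr.
  by apply: cvgD; [apply: cvgMl_tmp|]; exact: cvg_dot.
- rewrite -lim_norm //; apply: limr_le; first exact: is_cvg_norm.
  exact: nearW.
- by exists l => h; rewrite -fl; exact: cvg_dot.
Qed.

Lemma null_dot_bounded (T : Type) (U : set_system T) (r b : T -> H) (C : R) :
  Filter U -> `|r t| @[t --> U] --> (0 : R) -> (forall t, `|b t| <= C) ->
  dot (r t) (b t) @[t --> U] --> (0 : R).
Proof.
move=> FU r0 bC; apply/norm_cvg0P.
have lim_bound : `|r t| * C @[t --> U] --> (0 : R).
  by rewrite -(mul0r C); exact: cvgMr_tmp.
apply: squeeze_cvgr (cvg_cst (0 : R)) lim_bound.
apply: nearW => t; rewrite normr_ge0 /=.
by apply: le_trans (cauchy_schwarz _ _) _; rewrite ler_wpM2l.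
Qed.

(** * Maximally monotone operators *)

(** Adjoining [(p, u)] to the graph keeps it monotone, so by maximality the pair was already
    there. *)
Lemma max_monotone_mem (F : H -> set H) (p u : H) :
  max_monotone dot F ->
  (forall y v, F y v -> 0 <= dot (u - v) (p - y)) -> F p u.
Proof.
move=> [Fmon Fmax] pu_mon; apply: contrapT => nFpu; apply: Fmax.
exists (fun y v => F y v \/ (y = p /\ v = u)); split.
- move=> y v y' v' [Fyv|[-> ->]] [Fyv'|[-> ->]].
  + exact: Fmon.
  + rewrite -(opprB u) -(opprB p) dotNl dotNr opprK; exact: pu_mon.
  + exact: pu_mon.
  + by rewrite !subrr dot_ge0.
- split=> [z|GF]; first by left.
  by apply: nFpu; apply: (GF (p, u)); right.
Qed.

(* The pairing [dot (r t) (y t)] of a strongly null family with a bounded one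
   is null, so monotonicity passes to the limit and maximality applies. *)
Lemma max_monotone_demiclosed (F : H -> set H) (T : Type) (U : set_system T)
    (y r : T -> H) (M : R) (l : H) :
  ProperFilter U -> max_monotone dot F -> (forall t, F (y t) (r t)) ->
  (forall t, `|y t| <= M) -> `|r t| @[t --> U] --> (0 : R) ->
  (forall h, dot (y t) h @[t --> U] --> dot l h) -> F l 0.
Proof.
move=> UP Fmax Fyr yM r0 yl; apply: max_monotone_mem => // z v Fzv.
(* This is [dot (r t - v) (y t - z)] expanded so that each term has a limit. *)
have : dot (r t) (y t) - dot (r t) z - (dot (y t) v - dot z v) @[t --> U]
    --> 0 - 0 - (dot l v - dot z v).
  apply: cvgB; [apply: cvgB|apply: cvgB].
  - exact: null_dot_bounded yM.
  - exact: (null_dot_bounded UP r0 (fun=> lexx `|z|)).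
  - exact: yl.
  - exact: cvg_cst.
have -> : 0 - 0 - (dot l v - dot z v) = dot (0 - v) (l - z).
  by rewrite !sub0r !dotE (dotC v l) (dotC v z); ring.
move=> lim_pairing; rewrite -(cvg_lim _ lim_pairing) //.
apply: limr_ge; first exact: cvgP lim_pairing.
apply: nearW => t; have := Fmax.1 _ _ _ _ (Fyr t) Fzv.
by rewrite !dotE (dotC v (y t)) (dotC v z); lra.
Qed.

(** * Opial's argument *)

Lemma fejer_weak_cvg (S : set H) (x : nat -> H) :
  (forall s, S s -> cvg (`|x k - s| ^+ 2 @[k --> \oo])) ->
  (exists M, forall k, `|x k| <= M) ->
  (forall U l, UltraFilter U -> \oo `<=` U ->
    (forall h, dot (x k) h @[k --> U] --> dot l h) -> S l) ->
  exists2 l, S l & weak_cvg dot x l.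
Proof.
move=> dist_cvg [M xM] cluster_in.
(* One ultrafilter fixes the candidate [l]; the limit along any other is then compared with it. *)
have [U [UU ooU]] := ultraFilterLemma eventually_filter.
have [l xl] := ultra_bounded_weak_cvg UU xM.
have Sl : S l by exact: cluster_in xl.
exists l => // h; apply: cvg_ultra_finer => V VU ooV.
have [l' xl'] := ultra_bounded_weak_cvg VU xM.
suff -> : l = l' by exact: xl'.
have Sl' : S l' by exact: cluster_in xl'.
have UP := @ultra_proper _ _ UU; have VP := @ultra_proper _ _ VU.
(* Polarisation writes this pairing through the distances to [l] and [l'], which converge since both
   points lie in [S]. *)
have cvg_diff : cvg (dot (x k) (l - l') @[k --> \oo]).
  have -> : (fun k => dot (x k) (l - l')) =
      (fun k => 2^-1 * (`|x k - l'| ^+ 2 - `|x k - l| ^+ 2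
                        + (dot l l - dot l' l'))).
    apply/funext => k; rewrite !dotP !dotE (dotC l (x k)) (dotC l' (x k)).
    by field.
  apply: is_cvgMl_tmp; apply: is_cvgD; last exact: is_cvg_cst.
  by apply: is_cvgB; exact: dist_cvg.
pose c := lim (dot (x k) (l - l') @[k --> \oo]).
have cU : dot l (l - l') = c.
  apply: (cvg_unique _ (xl (l - l'))) => //.
  exact: cvg_trans (cvg_app _ ooU) cvg_diff.
have cV : dot l' (l - l') = c.
  apply: (cvg_unique _ (xl' (l - l'))) => //.
  exact: cvg_trans (cvg_app _ ooV) cvg_diff.
apply/eqP; rewrite -subr_eq0 -normr_eq0 -sqrf_eq0 dotP.
by rewrite dotDl dotNl cU cV subrr.
Qed.

End InnerProduct.

(** * One step of Tseng's algorithm *)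

Section Tseng.
Variables (R : realType) (H : completeNormedModType R).
Variables (gamma L : R) (B : H -> H) (A : H -> set H).
Hypotheses (gamma_gt0 : 0 < gamma) (B_lip : L.-lipschitz B).
Hypothesis A_res : resolvent_single_valued gamma A.

Lemma lipschitz_normB x y : `|B x - B y| <= L * `|x - y|.
Proof. by have := B_lip; rewrite /dominated_by => /(_ (x, y)); apply. Qed.

(** The resolvent gives [x - gamma *: B x = y + gamma *: a] with [a] in [A y]; inserting this in the
    update leaves [x - x' = gamma *: (a + B y)]. *)
Lemma tseng_mem x :
  op_add A B (tseng_y gamma A B x)
    (gamma^-1 *: (x - tseng_step gamma A B x)).
Proof.
rewrite /tseng_step /=; set y := tseng_y gamma A B x.
have [z [Rz _]] := A_res (x - gamma *: B x).
have [a Aya ya] : resolvent gamma A (x - gamma *: B x) y.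
  by apply: getPex; exists z.
exists a => //.
have -> : x - (y + gamma *: (B x - B y)) = gamma *: (a + B y).
  rewrite scalerBr scalerDr opprD opprB [_ - gamma *: B x]addrC.
  by rewrite addrCA (addrA x) -ya -addrA addKr.
by rewrite scalerK ?gt_eqF.
Qed.

Lemma tseng_step_dist x :
  `|tseng_step gamma A B x - tseng_y gamma A B x| <=
  gamma * L * `|x - tseng_y gamma A B x|.
Proof.
rewrite /tseng_step /= addrAC subrr add0r normrZ gtr0_norm // -mulrA.
by rewrite ler_pM2l // lipschitz_normB.
Qed.

Variable dot : {dot H for idfun}.
Hypothesis dotP : hilbert_dot dot.

(* |x - s|^2 - |x' - s|^2 = 2 <x - x', y - s> + |x - y|^2 - |x' - y|^2. *)
Lemma tseng_step_fejer x s :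
  monotone dot (op_add A B) -> op_inv (op_add A B) 0 s ->
  `|tseng_step gamma A B x - s| ^+ 2 <=
  `|x - s| ^+ 2 -
  (1 - gamma ^+ 2 * L ^+ 2) * `|x - tseng_y gamma A B x| ^+ 2.
Proof.
move=> ABmon Ss; have := ABmon _ _ _ _ (tseng_mem x) Ss.
have := tseng_step_dist x.
set x' := tseng_step gamma A B x; set y := tseng_y gamma A B x.
(* The right-hand side is nonnegative because it bounds a norm. *)
rewrite -ler_sqr ?nnegrE //; last first.
  by apply: le_trans (tseng_step_dist x).
rewrite !exprMn !dotP subr0 dotZl pmulr_rge0 ?invr_gt0 //.
move: x' y => x' y; rewrite !dotE.
rewrite (dotC _ y x) (dotC _ y x') (dotC _ s x) (dotC _ s x').
move: (gamma ^+ 2 * L ^+ 2) => c; lra.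
Qed.

End Tseng.

(** * Convergence of the iterates *)

Theorem theorem3 (R : realType) (H : completeNormedModType R)
    (dot : {dot H for idfun}) (dotP : hilbert_dot dot)
    (gamma L : R) (gamma_gt0 : 0 < gamma) (L_gt0 : 0 < L)
    (B : H -> H) (B_lip : L.-lipschitz B)
    (A : H -> set H)
    (A_res : resolvent_single_valued gamma A)
    (AB_max : max_monotone dot (op_add A B))
    (S_neq0 : op_inv (op_add A B) 0 !=set0)
    (step_bound : exists eps : R, 0 < eps /\ gamma ^+ 2 * L ^+ 2 <= 1 - eps)
    (x0 : H) :
  exists xt : H, op_inv (op_add A B) 0 xt /\
    weak_cvg dot (tseng gamma A B x0) xt.
Proof.
have [eps [eps_gt0 gL]] := step_bound; have [s Ss] := S_neq0.
set x := tseng gamma A B x0; pose y k := tseng_y gamma A B (x k).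
have fejer p k : op_inv (op_add A B) 0 p ->
    `|x k.+1 - p| ^+ 2 <= `|x k - p| ^+ 2 - eps * `|x k - y k| ^+ 2.
  move=> Sp.
  have := tseng_step_fejer gamma_gt0 B_lip A_res dotP (x k) AB_max.1 Sp.
  move=> /le_trans; apply.
  by rewrite lerD2l lerN2 ler_wpM2r ?sqr_ge0 //; lra.
have dist_noninc p : op_inv (op_add A B) 0 p ->
    {homo (fun k => `|x k - p| ^+ 2) : n m / (n <= m)%N >-> m <= n}.
  move=> Sp; apply/nonincreasing_seqP => k.
  apply: le_trans (fejer p k Sp) _.
  by rewrite gerBl mulr_ge0 ?sqr_ge0 // ltW.
have dist_cvg p : op_inv (op_add A B) 0 p ->
    cvg (`|x k - p| ^+ 2 @[k --> \oo]).
  move=> Sp; apply: nonincreasing_is_cvgn; first exact: dist_noninc.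
  by exists 0 => _ [k _ <-]; exact: sqr_ge0.
have x_bounded k : `|x k| <= `|x 0%N - s| + `|s|.
  rewrite -{1}(subrK s (x k)); apply: le_trans (ler_normD _ _) _.
  by rewrite lerD2r -ler_sqr ?nnegrE // dist_noninc.
(* The bound is a multiple of the decrements of a convergent sequence, hence null. *)
have xy_sqr k : `|x k - y k| ^+ 2 <=
    eps^-1 * (`|x k - s| ^+ 2 - `|x k.+1 - s| ^+ 2).
  by rewrite ler_pdivlMl //; have := fejer s k Ss; lra.
have xy0 : `|x k - y k| @[k --> \oo] --> (0 : R).
  have : eps^-1 * (`|x k - s| ^+ 2 - `|x k.+1 - s| ^+ 2) @[k --> \oo]
      --> (0 : R).
    rewrite -(mulr0 eps^-1); apply: cvgMl_tmp.
    rewrite -(subrr (lim (`|x k - s| ^+ 2 @[k --> \oo]))).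
    apply: cvgB; first exact: dist_cvg.
    by rewrite (cvg_shiftS (fun k => `|x k - s| ^+ 2)); exact: dist_cvg.
  move=> /cvgr0Pnorm_lt lim0; apply/cvgr0Pnorm_lt => e e0.
  have := lim0 (e ^+ 2); rewrite exprn_gt0 // => /(_ isT).
  apply: filterS => k /(le_lt_trans (ler_norm _)) lt_e.
  by rewrite normr_id -ltr_sqr ?nnegrE ?(ltW e0) // (le_lt_trans (xy_sqr k)).
(* The element of [(A + B) (y k)] provided by [tseng_mem]. *)
pose r k := gamma^-1 *: (x k - x k.+1).
have r0 : `|r k| @[k --> \oo] --> (0 : R).
  have lim_bound : gamma^-1 * (1 + gamma * L) * `|x k - y k| @[k --> \oo]
      --> (0 : R).
    by rewrite -(mulr0 (gamma^-1 * (1 + gamma * L))); exact: cvgMl_tmp.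
  apply: squeeze_cvgr (cvg_cst (0 : R)) lim_bound.
  apply: nearW => k; rewrite normr_ge0 /= normrZ gtr0_norm ?invr_gt0 //.
  rewrite -mulrA ler_pM2l ?invr_gt0 // mulrDl mul1r.
  apply: le_trans (ler_distD (y k) _ _) _; rewrite lerD2l distrC.
  exact: tseng_step_dist.
(* The first two terms bound [|x k - y k|] through [t <= 1 + t ^+ 2], the last one bounds
   [|x k|]. *)
pose M := 1 + `|x 0%N - s| ^+ 2 / eps + (`|x 0%N - s| + `|s|).
have y_bounded k : `|y k| <= M.
  rewrite -(subKr (x k) (y k)); apply: le_trans (ler_normB _ _) _.
  rewrite addrC lerD //.
  have : `|x k - y k| ^+ 2 <= `|x 0%N - s| ^+ 2 / eps.
    apply: le_trans (xy_sqr k) _; rewrite mulrC ler_pM2r ?invr_gt0 //.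
    apply: le_trans (dist_noninc s Ss 0%N k isT).
    by rewrite gerBl sqr_ge0.
  have := sqr_ge0 (`|x k - y k| - 1); have := normr_ge0 (x k - y k).
  rewrite sqrrB1; nra.
have [l Sl xl] : exists2 l, op_inv (op_add A B) 0 l & weak_cvg dot x l.
  apply: fejer_weak_cvg => //; first by exists (`|x 0%N - s| + `|s|).
  move=> U l UU ooU xl; have UP := @ultra_proper _ _ UU.
  have cvgU (f : nat -> R) : f @ \oo --> (0 : R) -> f @ U --> (0 : R).
    by apply: cvg_trans; exact: cvg_app.
  apply: (max_monotone_demiclosed dotP UP AB_max _ y_bounded (cvgU _ r0)).
    by move=> k; exact: tseng_mem.
  move=> h; rewrite -(subr0 (dot l h)).
  (* [y k] inherits the weak limit of [x k] because their difference is strongly null. *)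
  have -> : (fun k => dot (y k) h) = (fun k => dot (x k) h - dot (x k - y k) h).
    by apply/funext => k; rewrite dotDl dotNl; ring.
  apply: cvgB; first exact: xl.
  exact: (null_dot_bounded dotP UP (cvgU _ xy0) (fun=> lexx `|h|)).
by exists l.
Qed.
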